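(* In the categorical label-shift setup, assume moreover that $T_g$ has full column rank and that $\theta_{\max}\ge\|\theta\|$. Let $\delta\in(0,1)$ and suppose $n\ge\frac{32}{\alpha}\|T_g^\dagger\|^2 d\log\frac{6(d+k)}{\delta}$. Then with probability at least $1-\delta$ the estimator $\widehat\theta=\widehat T_g^\dagger(\widehat q_g-\widehat p_g)$ satisfies $$\|\widehat\theta-\theta\|\le 2\|T_g^\dagger\|\Big(\sqrt{\frac{d}{\alpha n}\log\frac{6d}{\delta}}+\sqrt{\frac{d}{m}\log\frac{6d}{\delta}}+2\theta_{\max}\sqrt{\frac{2d}{\alpha n}\log\frac{6(d+k)}{\delta}}\Big).$$
   Context: Categorical label-shift setup: $\mathcal X$ is a measurable space and $\mathcal Y=\{1,\dots,k\}$. $\mathbb P$ (source) and $\mathbb Q$ (target) are probability measures on $\mathcal X\times\mathcal Y$ with $\mathbb P(Y=j)>0$ for all $j$, and label shift holds: for each $j$, the conditional distribution of $X$ given $Y=j$ is the same under $\mathbb P$ and $\mathbb Q$. Importance weights: $\omega\in\mathbb R^k$, $\omega_j=\mathbb Q(Y=j)/\mathbb P(Y=j)$, and $\theta:=\omega-\vec 1$, where $\vec 1$ is the all-ones vector. Fix a measurable $g:\mathcal X\to[-1,1]^d$. Define $p_g=\mathbb E_{\mathbb P}[g(X)]\in\mathbb R^d$, $q_g=\mathbb E_{\mathbb Q}[g(X)]\in\mathbb R^d$, and $T_g\in\mathbb R^{d\times k}$ by $(T_g)_{ij}=\mathbb E_{\mathbb P}[g_i(X)\mathbf 1\{Y=j\}]$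 (so that $q_g-p_g=T_g\theta$). Data: $\alpha n$ (a positive integer, $\alpha\in(0,1]$) i.i.d. samples $(x_i,y_i)$ from $\mathbb P$, and, independently, $m$ i.i.d. samples $x'_j$ from the $\mathcal X$-marginal of $\mathbb Q$. Estimates: $\widehat p_g=\frac{1}{\alpha n}\sum_{i}g(x_i)$, $\widehat q_g=\frac1m\sum_j g(x'_j)$, $\widehat T_g=\frac{1}{\alpha n}\sum_i g(x_i)e_{y_i}^\top$, where $e_l\in\mathbb R^k$ is the $l$-th standard basis vector. Vector norms are Euclidean, matrix norms spectral; $\log$ is the natural logarithm. $T^\dagger$ is the Moore–Penrose pseudoinverse, and $\|T_g^\dagger\|$ is the inverse of the smallest singular value of $T_g$. *)

(* Defs.v *)
From HB Require Import structures.
From mathcomp Require Import all_boot all_order all_algebra.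
From mathcomp Require Import all_classical all_reals all_analysis.
Set Implicit Arguments. Unset Strict Implicit. Unset Printing Implicit Defensive.
Import Order.TTheory GRing.Theory Num.Theory.
Import numFieldNormedType.Exports.
Local Open Scope classical_set_scope.
Local Open Scope ring_scope.

(* The label set {1,...,K} is represented by 'I_K with K = k.+1 (K >= 1),
   equipped with the discrete sigma-algebra. *)
HB.instance Definition _ (n : nat) := isPointed.Build 'I_n.+1 ord0.
HB.instance Definition _ (n : nat) := @isMeasurable.Build default_measure_display
  'I_n.+1 discrete_measurable discrete_measurable0
  discrete_measurableC discrete_measurableU.

Section Defs.
Variable R : realType.

Definition euclid n (v : 'cV[R]_n) : R := Num.sqrt (\sum_i v i 0 ^+ 2).

Definition spec_norm m n (A : 'M[R]_(m, n)) : R :=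
  sup [set euclid (A *m x) | x in [set x : 'cV[R]_n | euclid x <= 1]].

Definition is_MP_pinv m n (A : 'M[R]_(m, n)) (B : 'M[R]_(n, m)) : Prop :=
  [/\ A *m B *m A = A, B *m A *m B = B,
      (A *m B)^T = A *m B & (B *m A)^T = B *m A].

(* The Moore--Penrose pseudoinverse (it exists and is unique) *)
Definition mp_pinv m n (A : 'M[R]_(m, n)) : 'M[R]_(n, m) :=
  xget 0 (is_MP_pinv A).

Context (dX : measure_display) (T : measurableType dX) (k : nat).
Local Notation K := k.+1.

Definition pop_mean d (P : probability (T * 'I_K)%type R) (g : 'I_d -> T -> R)
  : 'cV[R]_d := \col_i fine (\int[P]_z (g i z.1)%:E).

Definition pop_T d (P : probability (T * 'I_K)%type R) (g : 'I_d -> T -> R)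
  : 'M[R]_(d, K) :=
  \matrix_(i, j) fine (\int[P]_z (g i z.1 * (z.2 == j)%:R)%:E).

Definition label_prob (P : probability (T * 'I_K)%type R) (j : 'I_K) : R :=
  fine (P [set z | z.2 = j]).

Definition omega (P Q : probability (T * 'I_K)%type R) : 'cV[R]_K :=
  \col_j (label_prob Q j / label_prob P j).

Definition theta (P Q : probability (T * 'I_K)%type R) : 'cV[R]_K :=
  omega P Q - const_mx 1.

(* label shift: P(X in A | Y = j) = Q(X in A | Y = j) whenever both
   conditionals are defined (P(Y=j) > 0 is assumed separately). *)
Definition label_shift (P Q : probability (T * 'I_K)%type R) : Prop :=
  forall j : 'I_K, 0 < label_prob Q j ->
  forall A : set T, measurable A ->
    fine (P (A `*` [set j])) / label_prob P j
    = fine (Q (A `*` [set j])) / label_prob Q j.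

Definition iid_samples dO (O : measurableType dO) (Pw : probability O R)
  (P Q : probability (T * 'I_K)%type R) N m
  (xs : 'I_N -> O -> (T * 'I_K)%type) (xq : 'I_m -> O -> T) : Prop :=
  (forall i, measurable_fun setT (xs i)) /\
  (forall j, measurable_fun setT (xq j)) /\
  forall (A : 'I_N -> set (T * 'I_K)%type) (B : 'I_m -> set T),
    (forall i, measurable (A i)) -> (forall j, measurable (B j)) ->
    Pw (\bigcap_(i in [set: 'I_N]) (xs i @^-1` A i)
        `&` \bigcap_(j in [set: 'I_m]) (xq j @^-1` B j))
    = (\prod_(i < N) P (A i) * \prod_(j < m) Q (B j `*` setT))%E.

Definition emp_p d N (g : 'I_d -> T -> R) (s : 'I_N -> (T * 'I_K)%type) : 'cV[R]_d :=
  \col_i ((N%:R)^-1 * \sum_(l < N) g i (s l).1).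

Definition emp_q d m (g : 'I_d -> T -> R) (s : 'I_m -> T) : 'cV[R]_d :=
  \col_i ((m%:R)^-1 * \sum_(l < m) g i (s l)).

Definition emp_T d N (g : 'I_d -> T -> R) (s : 'I_N -> (T * 'I_K)%type)
  : 'M[R]_(d, K) :=
  \matrix_(i, j) ((N%:R)^-1 * \sum_(l < N) g i (s l).1 * ((s l).2 == j)%:R).

Definition theta_hat d N m (g : 'I_d -> T -> R)
  (s : 'I_N -> (T * 'I_K)%type) (s' : 'I_m -> T) : 'cV[R]_K :=
  mp_pinv (emp_T g s) *m (emp_q g s' - emp_p g s).

End Defs.

(* Main.v *)
Require Import Defs.
From HB Require Import structures.
From mathcomp Require Import all_boot all_order all_algebra.
From mathcomp Require Import all_classical all_reals all_analysis.
From mathcomp Require Import measurable_realfun ring lra.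
Set Implicit Arguments. Unset Strict Implicit. Unset Printing Implicit Defensive.
Import Order.TTheory GRing.Theory Num.Theory.
Import numFieldNormedType.Exports.
Local Open Scope classical_set_scope.
Local Open Scope ring_scope.

(* Let Z be a random vector with |Z| <= r and mean mu. Then
     E cosh(l |s + Z - mu|) <= exp(l^2 r^2 / 2) cosh(l |s|),
   with the bound r on Z itself rather than on Z - mu: the left-hand side is
   at most an affine function of <s - mu, Z> by convexity of u |-> cosh(sqrt u),
   and integrating leaves Hoeffding's inequality for a two-point law. Iterating
   over N independent samples and applying Markov's inequality, the empirical
   mean deviates from mu by more than r sqrt(2 log(6/delta) / N) with
   probability at most delta/3, in any dimension.

   This is applied with r = sqrt d to p, to q and to T in Frobenius norm. The
   lower bound on n then gives |T^+| |That - T| <= 1/4, so |That^+| <= 4/3 |T^+|,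
   and label shift (q - p = T theta) yields
     thetahat - theta = That^+ ((qhat - q) - (phat - p) - (That - T) theta).
   The factor sqrt 2 lost against the stated bounds on p and q is absorbed by
   4/3 * sqrt 2 <= 2. *)

(** * Hyperbolic inequalities *)

Section Hyperbolic.
Variable R : realType.
Implicit Types x y p q w : R.

Lemma is_derive_ge0_homo (f df : R -> R) :
  (forall x, is_derive x 1 f (df x)) -> (forall x, 0 <= x -> 0 <= df x) ->
  forall x, 0 <= x -> f 0 <= f x.
Proof.
move=> fd df0 x x0.
apply: (@ger0_derive1_ndecr _ f 0 x) => //.
- by move=> y; rewrite in_itv/= => /andP[y0 _]; rewrite derive1E derive_val df0// ltW.
- apply: continuous_subspaceT => y; apply: differentiable_continuous.
  by apply/derivable1_diffP; exact: ex_derive.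
Qed.

(** The logarithmic derivative [S / C] of the moment generating function [C] has derivative
    [1 - (S / C)^2 <= 1], so it stays below [y + (p - q)]; integrating once more gives the exponent.
    This is Hoeffding's lemma for a random sign. *)
Lemma two_point_mgf_ge0 p q x : 0 <= p -> 0 <= q -> p + q = 1 -> 0 <= x ->
  p * expR x + q * expR (- x) <= expR ((p - q) * x + x ^+ 2 / 2).
Proof.
move=> p0 q0 pq x0.
pose C y := p * expR y + q * expR (- y).
pose S y := p * expR y - q * expR (- y).
have C0 y : 0 < C y.
  rewrite /C; have [pz|pn0] := eqVneq p 0.
    have -> : q = 1 by lra.
    by rewrite pz mul0r add0r mul1r expR_gt0.
  have pp : 0 < p by rewrite lt_neqAle eq_sym pn0.
  by rewrite ltr_wpDr ?mulr_ge0 ?expR_ge0// mulr_gt0// expR_gt0.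
have dC y : is_derive y 1 C (S y).
  apply: trigger_derive; rewrite /GRing.scale/= /S; lra.
have dS y : is_derive y 1 S (C y).
  apply: trigger_derive; rewrite /GRing.scale/= /C; lra.
have SC y : 0 <= y -> S y <= (y + (p - q)) * C y.
  move=> y0; pose K z := z + (p - q) - S z * (C z)^-1.
  have Cn z : C z != 0 by rewrite gt_eqF.
  have dK (z : R) : is_derive z 1 K ((S z / C z) ^+ 2).
    pose dV := is_deriveV (Cn z) (dC z).
    apply: trigger_derive; rewrite /GRing.scale/=.
    by have := Cn z; move: (S z) (C z) => s c ?; field.
  have := is_derive_ge0_homo dK (fun z _ => sqr_ge0 _) y0.
  rewrite /K {1}/S {1}/C oppr0 expR0 !mulr1 pq divr1 add0r subrr subr_ge0.
  by rewrite ler_pdivrMr.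
(* Minus the ratio of the two sides: it is [- 1] at 0 and nondecreasing by [SC]. *)
pose G y := - (C y * expR (- ((p - q) * y + y ^+ 2 / 2))).
have dG (y : R) : is_derive y 1 G
    (((y + (p - q)) * C y - S y) * expR (- ((p - q) * y + y ^+ 2 / 2))).
  apply: trigger_derive; rewrite /GRing.scale/=.
  by field.
have dG0 y : 0 <= y ->
    0 <= ((y + (p - q)) * C y - S y) * expR (- ((p - q) * y + y ^+ 2 / 2)).
  by move=> y0; rewrite mulr_ge0 ?expR_ge0// subr_ge0 SC.
have := is_derive_ge0_homo dG dG0 x0.
have -> : G 0 = - 1.
  by rewrite /G /C oppr0 expR0 !mulr1 pq mulr0 expr0n/= mul0r addr0 oppr0 expR0 mulr1.
by rewrite /G lerN2 expRN ler_pdivrMr ?expR_gt0// mul1r.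
Qed.

Lemma two_point_mgf p q x : 0 <= p -> 0 <= q -> p + q = 1 ->
  p * expR x + q * expR (- x) <= expR ((p - q) * x + x ^+ 2 / 2).
Proof.
move=> p0 q0 pq; have [x0|x0] := leP 0 x; first exact: two_point_mgf_ge0.
have := @two_point_mgf_ge0 q p (- x) q0 p0; rewrite addrC opprK => /(_ pq).
rewrite addrC (_ : (q - p) * - x + (- x) ^+ 2 / 2 = (p - q) * x + x ^+ 2 / 2); last by field.
by apply; rewrite oppr_ge0 ltW.
Qed.

Definition cosh x := (expR x + expR (- x)) / 2.
Definition sinh x := (expR x - expR (- x)) / 2.

Lemma cosh_gt0 x : 0 < cosh x.
Proof. by rewrite divr_gt0// addr_gt0// expR_gt0. Qed.

Lemma coshN x : cosh (- x) = cosh x.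
Proof. by rewrite /cosh opprK addrC. Qed.

Lemma cosh_norm x : cosh `|x| = cosh x.
Proof. by case: (ger0P x) => // _; rewrite coshN. Qed.

Lemma cosh0 : cosh 0 = 1.
Proof. by rewrite /cosh oppr0 expR0; field. Qed.

Lemma coshD x y : cosh (x + y) = cosh x * cosh y + sinh x * sinh y.
Proof. by rewrite /cosh /sinh opprD !expRD; field. Qed.

Lemma coshB x y : cosh (x - y) = cosh x * cosh y - sinh x * sinh y.
Proof. by rewrite /cosh /sinh opprD opprK !expRD; field. Qed.

Lemma cosh_le x y : 0 <= x -> x <= y -> cosh x <= cosh y.
Proof.
move=> x0 xy; rewrite /cosh ler_pM2r// !expRN.
have a1 : 1 <= expR x by rewrite -expR0 ler_expR.
have ab : expR x <= expR y by rewrite ler_expR.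
move: (expR x) (expR y) a1 ab => a b a1 ab.
have a0 : 0 < a by lra. have b0 : 0 < b by lra.
rewrite -subr_ge0 (_ : _ - _ = (b - a) * (a * b - 1) / (a * b)); last first.
  by field; rewrite !gt_eqF.
have ab1 : 1 <= a * b by rewrite -[1]mulr1 ler_pM//; lra.
apply: divr_ge0; last by rewrite ltW// mulr_gt0.
by rewrite mulr_ge0// subr_ge0.
Qed.

(** Induction: once the induction hypothesis is used, the remaining gap is
    [p * q * ((a - b) * (a^n - b^n))], whose last two factors have the same sign. *)
Lemma convex_exprn p q (a b : R) n : 0 <= p -> 0 <= q -> p + q = 1 ->
  0 <= a -> 0 <= b -> (p * a + q * b) ^+ n <= p * a ^+ n + q * b ^+ n.
Proof.
move=> p0 q0 pq a0 b0; elim: n => [|n IH]; first by rewrite !expr0 !mulr1 pq.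
have c0 : 0 <= p * a + q * b by rewrite addr_ge0// mulr_ge0.
rewrite exprS; apply: (le_trans (ler_wpM2l c0 IH)).
rewrite -subr_ge0 !exprS.
have -> : p * (a * a ^+ n) + q * (b * b ^+ n)
   - (p * a + q * b) * (p * a ^+ n + q * b ^+ n)
   = p * q * ((a - b) * (a ^+ n - b ^+ n)).
  have -> : p = 1 - q by rewrite -pq addrK.
  by ring.
apply: (mulr_ge0 (mulr_ge0 p0 q0)).
have [ab|/ltW ab] := leP a b.
  by rewrite mulr_le0// subr_le0// lerXn2r.
by rewrite mulr_ge0// subr_ge0// lerXn2r.
Qed.

(** The odd terms are kept, as zeros, so that each partial sum is the average of those of the two
    exponential series. *)
Lemma cosh_series_cvg x :
  series (fun n => (x ^+ n + (- x) ^+ n) / n`!%:R / 2) @ \oo --> cosh x.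
Proof.
have -> : series (fun n => (x ^+ n + (- x) ^+ n) / n`!%:R / 2) =
   (fun n => (series (exp_coeff x) n + series (exp_coeff (- x)) n) * 2^-1).
  apply/funext => n; rewrite /series/= -big_split/= mulr_suml.
  by apply: eq_bigr => i _; rewrite /exp_coeff/= -mulrDl.
apply: cvgM; last exact: cvg_cst.
by apply: cvgD; exact: is_cvg_series_exp_coeff.
Qed.

(* Term by term in the power series, this is the convexity of u |-> u^n applied
   to x^2 + y^2 + 2wxy = (1+w)/2 (x+y)^2 + (1-w)/2 (x-y)^2. *)
Lemma cosh_sqrt_le x y w : -1 <= w <= 1 ->
  cosh (Num.sqrt (x ^+ 2 + y ^+ 2 + 2 * w * x * y))
  <= cosh x * cosh y + w * (sinh x * sinh y).
Proof.
move=> /andP[w1 w2]; set u := _ + _ + _.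
pose p := (1 + w) / 2; pose q := (1 - w) / 2.
have p0 : 0 <= p by rewrite /p; lra.
have q0 : 0 <= q by rewrite /q; lra.
have pq : p + q = 1 by rewrite /p /q; field.
have uE : u = p * (x + y) ^+ 2 + q * (x - y) ^+ 2 by rewrite /u /p /q; field.
have u0 : 0 <= u by rewrite uE addr_ge0// mulr_ge0// sqr_ge0.
(* The right-hand side is the same mixture of [cosh (x + y)] and [cosh (x - y)] as [u] is of the
   squares, so the two series can be compared term by term. *)
have -> : cosh x * cosh y + w * (sinh x * sinh y) = p * cosh (x + y) + q * cosh (x - y).
  by rewrite coshD coshB /p /q; field.
pose c z n : R := (z ^+ n + (- z) ^+ n) / n`!%:R / 2.
have cv : (fun n => p * series (c (x + y)) n + q * series (c (x - y)) n) @ \oo -->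
    p * cosh (x + y) + q * cosh (x - y).
  by apply: cvgD; apply: cvgM; (try exact: cvg_cst); exact: cosh_series_cvg.
rewrite -(cvg_lim _ cv)// -(cvg_lim _ (@cosh_series_cvg (Num.sqrt u)))//.
apply: ler_lim.
- by apply/cvg_ex; eexists; exact: cosh_series_cvg.
- by apply/cvg_ex; eexists; exact: cv.
near=> n; rewrite /series/= !mulr_sumr -big_split/=.
apply: ler_sum => i _; rewrite /c.
have fi : 0 <= (i`!%:R : R)^-1 by rewrite invr_ge0.
suff H : Num.sqrt u ^+ i + (- Num.sqrt u) ^+ i <=
  p * ((x + y) ^+ i + (- (x + y)) ^+ i) + q * ((x - y) ^+ i + (- (x - y)) ^+ i).
  move: H fi; move: (Num.sqrt u ^+ i + _) ((x + y) ^+ i + _) ((x - y) ^+ i + _) (_^-1).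
  move=> a b e f H fi; nra.
have NE (z : R) : (- z) ^+ i = (-1) ^+ (odd i) * z ^+ i.
  by rewrite signr_odd; exact: exprNn.
rewrite (NE (Num.sqrt u)) (NE (x + y)) (NE (x - y)).
(* Odd terms vanish on both sides; an even one is a power [i./2] of the squares. *)
case: (boolP (odd i)) => oi /=; first by rewrite expr1; lra.
rewrite expr0 !mul1r -[i]odd_double_half (negbTE oi) add0n -mul2n !exprM sqr_sqrtr//.
have := convex_exprn i./2 p0 q0 pq (sqr_ge0 (x + y)) (sqr_ge0 (x - y)).
by rewrite -uE; lra.
Unshelve. all: by end_near. Qed.

(** The left-hand side is the expectation of [cosh (x + e * y)] for a random sign [e] of mean [w],
    and [cosh z + w * sinh z] is the moment generating function of [e]. Splitting the outer cosh
    into two exponentials, [two_point_mgf] applies at [y] and at [- y]. *)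
Lemma hoeffding_cosh x y w : -1 <= w <= 1 ->
  cosh x * cosh y + w * (sinh x * sinh y) <= expR (y ^+ 2 / 2) * cosh (x + w * y).
Proof.
move=> /andP[w1 w2].
have H z : cosh z + w * sinh z <= expR (w * z + z ^+ 2 / 2).
  have := @two_point_mgf ((1 + w) / 2) ((1 - w) / 2) z.
  rewrite (_ : (1 + w) / 2 - (1 - w) / 2 = w); last by field.
  have -> : cosh z + w * sinh z = (1 + w) / 2 * expR z + (1 - w) / 2 * expR (- z).
    by rewrite /cosh /sinh; field.
  apply; lra.
have H1 := ler_wpM2l (expR_ge0 x) (H y).
have H2 := ler_wpM2l (expR_ge0 (- x)) (H (- y)).
move: H1 H2; rewrite -!expRD => H1 H2.
have -> : expR (y ^+ 2 / 2) * cosh (x + w * y) =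
  (expR (x + (w * y + y ^+ 2 / 2)) + expR (- x + (w * - y + (- y) ^+ 2 / 2))) / 2.
  by rewrite /cosh !expRD opprD mulrN sqrrN expRD; field.
apply: (@le_trans _ _ ((expR x * (cosh y + w * sinh y)
   + expR (- x) * (cosh (- y) + w * sinh (- y))) / 2)); last first.
  by rewrite ler_pM2r// lerD.
by rewrite le_eqVlt; apply/orP; left; apply/eqP; rewrite /cosh /sinh opprK; field.
Qed.

End Hyperbolic.

(** * One step of the exponential bound *)

Section Norm2.
Variables (R : realType) (I : finType).
Implicit Types (s z m : I -> R).

(** Vectors are functions on any finite type, so that a matrix, indexed by pairs, is covered with
    its Frobenius norm. *)
Definition dot s z := \sum_i s i * z i.
Definition norm2 s := Num.sqrt (\sum_i s i ^+ 2).

Lemma sum_sqr_ge0 s : 0 <= \sum_i s i ^+ 2.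
Proof. by apply: sumr_ge0 => i _; exact: sqr_ge0. Qed.

Lemma norm2_ge0 s : 0 <= norm2 s.
Proof. exact: sqrtr_ge0. Qed.

Lemma norm2_sqr s : norm2 s ^+ 2 = \sum_i s i ^+ 2.
Proof. by rewrite sqr_sqrtr// sum_sqr_ge0. Qed.

Lemma norm2D_sqr s z :
  norm2 (fun i => s i + z i) ^+ 2 = norm2 s ^+ 2 + 2 * dot s z + norm2 z ^+ 2.
Proof.
rewrite !norm2_sqr /dot mulr_sumr -!big_split/=.
by apply: eq_bigr => i _; ring.
Qed.

(** Cauchy-Schwarz, from the nonnegative sum of squares of [B * s i - dot s z * z i]. *)
Lemma dot_sqr_le s z : dot s z ^+ 2 <= norm2 s ^+ 2 * norm2 z ^+ 2.
Proof.
rewrite !norm2_sqr; set B := \sum_i z i ^+ 2; set A := \sum_i s i ^+ 2.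
have B0 : 0 <= B by exact: sum_sqr_ge0.
have [Bz|Bn0] := eqVneq B 0.
  rewrite /dot big1 ?expr0n ?Bz ?mulr0// => i _.
  have /eqP : z i ^+ 2 = 0.
    by apply: (psumr_eq0P _ Bz) => // j _; exact: sqr_ge0.
  by rewrite sqrf_eq0 => /eqP ->; rewrite mulr0.
have Bp : 0 < B by rewrite lt_neqAle eq_sym Bn0.
have := sum_sqr_ge0 (fun i => B * s i - dot s z * z i).
have -> : \sum_i (B * s i - dot s z * z i) ^+ 2 = B * (A * B - dot s z ^+ 2).
  rewrite (eq_bigr (fun i => B ^+ 2 * s i ^+ 2 - 2 * B * dot s z * (s i * z i)
     + dot s z ^+ 2 * z i ^+ 2)); last by move=> i _; ring.
  rewrite !big_split/= -!mulr_sumr sumrN -mulr_sumr -/A -/B -/(dot s z).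
  by ring.
by rewrite pmulr_rge0// subr_ge0.
Qed.

Lemma dot_le s z r : norm2 z <= r -> `|dot s z| <= norm2 s * r.
Proof.
move=> zr; apply: (@le_trans _ _ (norm2 s * norm2 z)); last first.
  by rewrite ler_wpM2l// norm2_ge0.
rewrite -(@ler_pXn2r _ 2)// ?nnegrE ?mulr_ge0 ?norm2_ge0//.
by rewrite real_normK ?num_real// exprMn dot_sqr_le.
Qed.

Lemma norm2D s z : norm2 (fun i => s i + z i) <= norm2 s + norm2 z.
Proof.
have s0 := norm2_ge0 s; have z0 := norm2_ge0 z.
rewrite -(@ler_pXn2r _ 2)// ?nnegrE ?norm2_ge0//; last by rewrite addr_ge0.
rewrite norm2D_sqr sqrrD.
have := ler_norm (dot s z); have := @dot_le s z _ (lexx _); lra.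
Qed.

(** The ratio is the parameter [w] of the hyperbolic inequalities. If [norm2 s * r] is 0 the
    quotient is 0 by convention, and the second conjunct survives because [dot s z] is then 0
    too. *)
Lemma dot_cosine s z r : norm2 z <= r ->
  -1 <= dot s z / (norm2 s * r) <= 1 /\
  dot s z = dot s z / (norm2 s * r) * (norm2 s * r).
Proof.
move=> zr; have r0 : 0 <= r := le_trans (norm2_ge0 z) zr.
have := dot_le s zr; have := mulr_ge0 (norm2_ge0 s) r0.
move: (norm2 s * r) => c c0 szc; rewrite -ler_norml normrM normfV (ger0_norm c0).
have [e|e] := eqVneq c 0.
  by move: szc; rewrite e normr_le0 invr0 !mulr0 ler01 => /eqP.
by split; [rewrite ler_pdivrMr ?mul1r// lt_neqAle eq_sym e|rewrite divfK].
Qed.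

(** Expand the squared norm, replace [norm2 z] by [r], and use [cosh_sqrt_le] at [l * norm2 s] and
    [l * r]. The resulting bound is affine in [z], so its expectation depends on the mean alone. *)
Lemma cosh_norm2D_le (l r : R) s z : 0 <= l -> norm2 z <= r ->
  cosh (l * norm2 (fun i => s i + z i)) <= cosh (l * norm2 s) * cosh (l * r)
    + sinh (l * norm2 s) * sinh (l * r) / (norm2 s * r) * dot s z.
Proof.
move=> l0 zr; set sg := norm2 s.
have r0 : 0 <= r := le_trans (norm2_ge0 z) zr.
have sg0 : 0 <= sg by exact: norm2_ge0.
pose w := dot s z / (sg * r).
have [w1 dotE] := dot_cosine s zr; rewrite -/sg -/w in w1 dotE.
have -> : sinh (l * sg) * sinh (l * r) / (sg * r) * dot s z
   = w * (sinh (l * sg) * sinh (l * r)) by rewrite /w; ring.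
apply: le_trans (cosh_sqrt_le _ _ w1).
apply: cosh_le; first by rewrite mulr_ge0// norm2_ge0.
rewrite -(@ler_pXn2r _ 2)// ?nnegrE ?sqrtr_ge0//; last first.
  by rewrite mulr_ge0// norm2_ge0.
rewrite exprMn norm2D_sqr -/sg dotE.
have -> : (l * sg) ^+ 2 + (l * r) ^+ 2 + 2 * w * (l * sg) * (l * r) =
   l ^+ 2 * (sg ^+ 2 + 2 * (w * (sg * r)) + r ^+ 2) by ring.
have H : sg ^+ 2 + 2 * (w * (sg * r)) + norm2 z ^+ 2 <=
    sg ^+ 2 + 2 * (w * (sg * r)) + r ^+ 2.
  by rewrite lerD2l ler_pXn2r// ?nnegrE ?norm2_ge0.
rewrite [leRHS]sqr_sqrtr; first by rewrite ler_wpM2l ?sqr_ge0.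
by rewrite mulr_ge0 ?sqr_ge0// (le_trans _ H)// -dotE -norm2D_sqr sqr_ge0.
Qed.

(** The affine bound of [cosh_norm2D_le], taken at the mean [m], is a two-point expectation, to
    which [hoeffding_cosh] applies. *)
Lemma cosh_affine_le (l r : R) s m : 0 <= l -> 0 <= r -> norm2 m <= r ->
  cosh (l * norm2 s) * cosh (l * r)
    + sinh (l * norm2 s) * sinh (l * r) / (norm2 s * r) * dot s m
  <= expR ((l * r) ^+ 2 / 2) * cosh (l * norm2 (fun i => s i + m i)).
Proof.
move=> l0 r0 mr; set sg := norm2 s.
have sg0 : 0 <= sg by exact: norm2_ge0.
pose w := dot s m / (sg * r).
have [w1 dotE] := dot_cosine s mr; rewrite -/sg -/w in w1 dotE.
have -> : sinh (l * sg) * sinh (l * r) / (sg * r) * dot s m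
   = w * (sinh (l * sg) * sinh (l * r)) by rewrite /w; ring.
apply: le_trans (hoeffding_cosh _ _ w1) _.
rewrite ler_wpM2l ?expR_ge0//.
have -> : l * sg + w * (l * r) = l * (sg + w * r) by ring.
rewrite -cosh_norm normrM (ger0_norm l0); apply: cosh_le; first by rewrite mulr_ge0.
rewrite ler_wpM2l// -(@ler_pXn2r _ 2)// ?nnegrE ?norm2_ge0//.
rewrite real_normK ?num_real// norm2D_sqr -/sg dotE.
(* For nonzero [s], [w * r] is the signed length of the projection of [m] on [s]. *)
suff : (w * r) ^+ 2 <= norm2 m ^+ 2 by lra.
have [sgz|sgn] := eqVneq sg 0.
  by rewrite /w sgz mul0r invr0 mulr0 mul0r expr0n sqr_ge0.
have sgp : 0 < sg ^+ 2 by rewrite exprn_gt0// lt_neqAle eq_sym sgn.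
rewrite -(ler_pM2l sgp); apply: le_trans (dot_sqr_le _ _).
by rewrite dotE -/sg le_eqVlt; apply/orP; left; apply/eqP; ring.
Qed.

End Norm2.

(** * Measurability, and integration over one sample *)

Lemma measurable_sqrt (R : realType) : measurable_fun [set: R] (@Num.sqrt R).
Proof. by apply: continuous_measurable_fun; exact: sqrt_continuous. Qed.

Lemma measurable_cosh (R : realType) : measurable_fun [set: R] (@cosh R).
Proof.
apply: (@measurable_funM _ _ _ _ (fun x : R => expR x + expR (- x)) (cst 2^-1)) => //.
apply: measurable_funD; first exact: measurable_expR.
by apply: measurableT_comp; [exact: measurable_expR|exact: oppr_measurable].
Qed.

Lemma measurable_norm2 (R : realType) (I : finType) dT (T : measurableType dT)
    (f : I -> T -> R) : (forall i, measurable_fun setT (f i)) ->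
  measurable_fun setT (fun t => norm2 (f ^~ t)).
Proof.
move=> mf; apply: (measurableT_comp (@measurable_sqrt R)).
by apply: measurable_sum => i; exact: measurable_funX.
Qed.

Section OneStep.
Context (R : realType) (I : finType) dT (T : measurableType dT).
Variables (mu : probability T R) (Z : I -> T -> R) (r : R).
Hypothesis mZ : forall i, measurable_fun setT (Z i).
Hypothesis Zr : forall t, norm2 (Z ^~ t) <= r.

Definition mean (i : I) : R := fine (\int[mu]_t (Z i t)%:E)%E.

Let bnd_ge0 : 0 <= r.
Proof. exact: le_trans (norm2_ge0 _) (Zr point). Qed.

Lemma integrable_coord i : mu.-integrable setT (EFin \o Z i).
Proof.
apply: measurable_bounded_integrable => //.
  by rewrite (le_lt_trans (probability_le1 _ _))// ltry.
exists r; split; first exact: num_real.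
move=> x rx t _ /=; apply: le_trans (ltW rx); apply: le_trans (Zr t).
rewrite -(@ler_pXn2r _ 2)// ?nnegrE ?norm2_ge0//.
rewrite real_normK ?num_real// norm2_sqr (bigD1 i)//= lerDl.
by apply: sumr_ge0 => j _; exact: sqr_ge0.
Qed.

Lemma meanE i : (\int[mu]_t (Z i t)%:E)%E = (mean i)%:E.
Proof. by rewrite /mean fineK// integrable_fin_num//; exact: integrable_coord. Qed.

Lemma integrable_dot s : mu.-integrable setT (fun t => (dot s (Z ^~ t))%:E).
Proof.
have -> : (fun t => (dot s (Z ^~ t))%:E) =
   (fun t => \sum_(i <- index_enum I) ((s i)%:E * (Z i t)%:E))%E.
  by apply/funext => t; rewrite /dot -sumEFin.
apply: integrable_sum => // i _; apply: integrableZl => //.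
exact: integrable_coord.
Qed.

Lemma integral_dot s : (\int[mu]_t (dot s (Z ^~ t))%:E)%E = (dot s mean)%:E.
Proof.
have -> : (fun t => (dot s (Z ^~ t))%:E) =
   (fun t => \sum_(i <- index_enum I) ((s i)%:E * (Z i t)%:E))%E.
  by apply/funext => t; rewrite /dot -sumEFin.
rewrite integral_sum//; last first.
  by move=> i; apply: integrableZl => //; exact: integrable_coord.
rewrite /dot -sumEFin; apply: eq_bigr => i _.
by rewrite integralZl ?meanE//; exact: integrable_coord.
Qed.

Lemma integral_affine a b s :
  (\int[mu]_t (a + b * dot s (Z ^~ t))%:E)%E = (a + b * dot s mean)%:E.
Proof.
under eq_integral do rewrite EFinD EFinM.
rewrite integralD//; last 2 first.
- exact: finite_measure_integrable_cst.
- by apply: integrableZl => //; exact: integrable_dot.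
rewrite integralZl//; last exact: integrable_dot.
rewrite integral_dot (integral_cst mu measurableT a%:E).
by rewrite [X in (_ * X)%E](_ : _ = 1%E) ?mule1//; exact: probability_setT.
Qed.

(** Integrating [dot mean Z <= norm2 mean * r] gives [norm2 mean ^+ 2 <= norm2 mean * r]. *)
Lemma norm2_mean_le : norm2 mean <= r.
Proof.
have H : dot mean mean <= norm2 mean * r.
  rewrite -lee_fin -integral_dot.
  apply: (@le_trans _ _ (\int[mu]_t (cst (norm2 mean * r)%:E t))%E).
    apply: le_integral => //.
    - exact: integrable_dot.
    - exact: finite_measure_integrable_cst.
    - move=> t _; rewrite lee_fin (le_trans (ler_norm _))//.
      exact: dot_le.
  rewrite integral_cst// [X in (_ * X)%E](_ : _ = 1%E) ?mule1//.
  exact: probability_setT.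
have [->//|n0] := eqVneq (norm2 mean) 0.
have np : 0 < norm2 mean by rewrite lt_neqAle eq_sym n0 norm2_ge0.
rewrite -(ler_pM2l np); apply: le_trans H.
by rewrite -expr2 norm2_sqr /dot; under eq_bigr do rewrite expr2.
Qed.

(** Centering is moved from [Z] to [s], giving [s'], so that only the bound [r] on [Z] itself is
    used. The pointwise affine bound integrates to its value at the mean, and [s' + mean] is [s]
    again. *)
Lemma integral_cosh_step (l : R) (s : I -> R) : 0 <= l ->
  (\int[mu]_t (cosh (l * norm2 (fun i => s i + (Z i t - mean i))))%:E
    <= (expR ((l * r) ^+ 2 / 2) * cosh (l * norm2 s))%:E)%E.
Proof.
move=> l0; pose s' i := s i - mean i.
have E1 t : norm2 (fun i => s i + (Z i t - mean i)) = norm2 (fun i => s' i + Z i t).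
  by congr norm2; apply/funext => i; rewrite /s'; ring.
have E2 : norm2 s = norm2 (fun i => s' i + mean i).
  by congr norm2; apply/funext => i; rewrite /s' subrK.
rewrite E2; under eq_integral do rewrite E1.
have := cosh_affine_le s' l0 bnd_ge0 norm2_mean_le.
rewrite -lee_fin; apply: le_trans.
rewrite -integral_affine; apply: ge0_le_integral => //.
- by move=> t _; rewrite lee_fin ltW// cosh_gt0.
- apply/measurable_EFinP; apply: (measurableT_comp (@measurable_cosh R)).
  apply: measurable_funM => //.
  by apply: measurable_norm2 => i; exact: measurable_funD.
- apply/measurable_EFinP; apply: measurable_funD => //.
  apply: measurable_funM => //; apply: measurable_sum => i.
  exact: measurable_funM.
- by move=> t _; rewrite lee_fin; exact: cosh_norm2D_le.
Qed.

End OneStep.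

(** * Sums of independent vectors *)

Section IndepPair.
Local Open Scope ereal_scope.
Context (R : realType) dO dT dW (O : measurableType dO) (T : measurableType dT)
  (W : measurableType dW).
Variables (Pw : probability O R) (mu : probability T R).
Variables (S : {mfun O >-> W}) (x : {mfun O >-> T}).

(** Uniqueness of the product measure, for the law of [(S, x)] under [Pw] restricted to [B]. The
    factor [c], which is the mass of [B], is absorbed by scaling [mu]. *)
Lemma indep_restr_prod (B : set O) (c : {nonneg R}) : measurable B ->
  (forall U C, measurable U -> measurable C ->
     Pw (S @^-1` U `&` x @^-1` C `&` B) = Pw (S @^-1` U) * (c%:num%:E * mu C)) ->
  forall V : set (W * T), measurable V ->
  Pw ((fun w => (S w, x w)) @^-1` V `&` B)
  = c%:num%:E * (distribution Pw S \x mu) V.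
Proof.
move=> mB H V mV.
have mp : measurable_fun setT (fun w => (S w, x w)) by exact: measurable_fun_pair.
have := @product_measure_unique _ _ _ _ R (distribution Pw S) (mscale c mu)
  (mscale c (distribution Pw S \x mu)).
move=> E1.
have E2 := @product_measure_unique _ _ _ _ R (distribution Pw S) (mscale c mu)
  (pushforward (mrestr Pw mB) (fun w => (S w, x w))).
rewrite -[LHS]/(pushforward (mrestr Pw mB) (fun w => (S w, x w)) V).
rewrite -[RHS]/(mscale c (distribution Pw S \x mu) V).
rewrite -E1//; last first.
  move=> U C mU mC; rewrite /mscale [RHS]muleCA; congr (_ * _).
  exact: product_measure1E.
by rewrite -E2.
Qed.

Hypothesis Sx : forall U C, measurable U -> measurable C ->
  Pw (S @^-1` U `&` x @^-1` C) = Pw (S @^-1` U) * mu C.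

(** Serves as conditioning on [S]: by independence the joint law is a product, and Tonelli
    integrates the second coordinate first. *)
Lemma integral_indep_pair (F : W * T -> \bar R) :
  measurable_fun setT F -> (forall z, 0 <= F z) ->
  \int[Pw]_w F (S w, x w) = \int[Pw]_w \int[mu]_t F (S w, t).
Proof.
move=> mF F0.
have mp : measurable_fun setT (fun w => (S w, x w)) by exact: measurable_fun_pair.
pose p : {mfun O >-> (W * T)%type} := mfun_Sub (mem_set mp).
transitivity (\int[distribution Pw p]_z F z).
  by rewrite ge0_integral_distribution.
transitivity (\int[distribution Pw S \x mu]_z F z).
  apply: eq_measure_integral => V mV _.
  have H := @indep_restr_prod setT (1%:nng)%R measurableT _ V mV.
  rewrite /= mul1e in H; rewrite -[RHS]H ?setIT// => U C mU mC.
  by rewrite setIT mul1e Sx.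
rewrite fubini_tonelli1//.
rewrite (ge0_integral_distribution S (f := fubini_F mu F))//.
- exact: measurable_fun_fubini_tonelli_F.
- by move=> s; apply: integral_ge0 => t _.
Qed.

End IndepPair.

(** * Exponential moment and tail of an iid sum *)

Section IidSum.
Context (R : realType) (D : nat) dO dT (O : measurableType dO) (T : measurableType dT).
Variables (Pw : probability O R) (mu : probability T R) (N : nat).
Variables (xs : 'I_N -> O -> T) (Z : 'I_D -> T -> R) (r : R).
Hypothesis mxs : forall i, measurable_fun setT (xs i).
Hypothesis xs_iid : forall A : 'I_N -> set T, (forall i, measurable (A i)) ->
  Pw (\bigcap_(i in [set: 'I_N]) xs i @^-1` A i) = (\prod_(i < N) mu (A i))%E.
Hypothesis mZ : forall j, measurable_fun setT (Z j).
Hypothesis Zr : forall t, norm2 (Z ^~ t) <= r.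

(** The index stays in ['I_N] with a cut-off at [n], so that induction on [n] keeps one family
    [xs]. *)
Definition partial_sum n w (j : 'I_D) : R :=
  \sum_(i < N | (i < n)%N) (Z j (xs i w) - mean mu Z j).

(** As a tuple the partial sum is a point of a measurable space and has a law. *)
Let part n w : D.-tuple R := [tuple partial_sum n w j | j < D].

Lemma measurable_partial_sum n j : measurable_fun setT (fun w => partial_sum n w j).
Proof.
rewrite /partial_sum; under eq_fun do rewrite big_mkcond.
apply: (@measurable_sum _ _ _ _ _ (index_enum 'I_N)
  (fun i w => if (i < n)%N then Z j (xs i w) - mean mu Z j else 0)) => i.
case: (i < n)%N => //.
by apply: measurable_funB => //; exact: measurableT_comp.
Qed.

Let mpart n : measurable_fun setT (part n).
Proof.
apply/measurable_fun_tnthP => j.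
rewrite [X in measurable_fun _ X](_ : _ = (fun w => partial_sum n w j)).
  exact: measurable_partial_sum.
by apply/funext => w /=; rewrite /part tnth_mktuple.
Qed.

Lemma partial_sumS (n : nat) (nN : (n < N)%N) w j :
  partial_sum n.+1 w j
  = partial_sum n w j + (Z j (xs (Ordinal nN) w) - mean mu Z j).
Proof.
rewrite /partial_sum (bigD1 (Ordinal nN))//= addrC; congr (_ + _).
apply: eq_bigl => i; rewrite ltnS leq_eqVlt -val_eqE/=.
by case: (ltngtP i n).
Qed.

Let add_centered (z : D.-tuple R * T) : D.-tuple R :=
  [tuple tnth z.1 j + (Z j z.2 - mean mu Z j) | j < D].

Let madd : measurable_fun setT add_centered.
Proof.
apply/measurable_fun_tnthP => j.
rewrite [X in measurable_fun _ X](_ : _ =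
    (fun z : D.-tuple R * T => tnth z.1 j + (Z j z.2 - mean mu Z j))); last first.
  by apply/funext => w /=; rewrite /add_centered tnth_mktuple.
apply: measurable_funD.
  by apply: (measurableT_comp (@measurable_tnth _ _ _ j)).
by apply: measurable_funB => //; exact: measurableT_comp.
Qed.

Let partS (n : nat) (nN : (n < N)%N) w :
  part n.+1 w = add_centered (part n w, xs (Ordinal nN) w).
Proof.
apply: eq_from_tnth => j; rewrite /add_centered /part !tnth_mktuple/=.
exact: partial_sumS.
Qed.

Let mfxs i : {mfun O >-> T} := mfun_Sub (mem_set (mxs i)).
Let mfpart n : {mfun O >-> D.-tuple R} := mfun_Sub (mem_set (mpart n)).

Lemma measurable_bigcap_preimage (A : 'I_N -> set T) : (forall i, measurable (A i)) ->
  measurable (\bigcap_(i in [set: 'I_N]) xs i @^-1` A i).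
Proof.
move=> mA; apply: fin_bigcap_measurable => // i _.
by rewrite -[X in measurable X]setTI; exact: mxs.
Qed.

(* The past sum is independent of the events of the later samples: the joint law
   of (part n, xs n), restricted to such an event, is determined on rectangles. *)
Let part_indep n (A : 'I_N -> set T) (U : set (D.-tuple R)) : (n <= N)%N ->
  measurable U -> (forall i, measurable (A i)) ->
  (forall i : 'I_N, (i < n)%N -> A i = setT) ->
  Pw (part n @^-1` U `&` \bigcap_(i in [set: 'I_N]) xs i @^-1` A i)
  = (Pw (part n @^-1` U) * \prod_(i < N) mu (A i))%E.
Proof.
elim: n => [|n IH] in A U * => [_|nN] mU mA AT.
  (* The empty sum is constant, so its preimages are everything or nothing. *)
  have part0 w w' : part 0 w = part 0 w'.
    by apply: eq_from_tnth => j; rewrite /part !tnth_mktuple /partial_sum !big_pred0.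
  have [Up|Up] := pselect (U (part 0 point)).
    rewrite (_ : part 0 @^-1` U = setT); last first.
      by apply/seteqP; split => // w _ /=; rewrite (part0 _ point).
    by rewrite setTI probability_setT mul1e xs_iid.
  rewrite (_ : part 0 @^-1` U = set0); last first.
    by apply/seteqP; split => // w /=; rewrite (part0 _ point).
  by rewrite set0I measure0 mul0e.
pose i0 := Ordinal nN.
have key (B : 'I_N -> set T) (V : set (D.-tuple R * T)) : measurable V ->
    (forall i, measurable (B i)) -> (forall i : 'I_N, (i < n.+1)%N -> B i = setT) ->
    Pw ((fun w => (part n w, xs i0 w)) @^-1` V
        `&` \bigcap_(i in [set: 'I_N]) xs i @^-1` B i)
    = ((\prod_(i < N) mu (B i)) * (distribution Pw (mfpart n) \x mu) V)%E.
  move=> mV mB BT.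
  set c := (\prod_(i < N) mu (B i))%E.
  have c0 : (0 <= c)%E by rewrite /c -xs_iid.
  have cfin : c \is a fin_num.
    by rewrite /c -xs_iid// fin_num_measure//; exact: measurable_bigcap_preimage.
  have c0' : 0 <= fine c by rewrite fine_ge0.
  rewrite -(fineK cfin).
  apply: (@indep_restr_prod _ _ _ _ _ _ _ Pw mu (mfpart n) (mfxs i0) _
            (NngNum c0')) => //.
    exact: measurable_bigcap_preimage.
  move=> {V mV} V C mV mC /=; rewrite fineK//.
  (* The event on sample [n] is put into slot [i0], where [B] is trivial; the new family is trivial
     before [n], as the induction hypothesis asks. *)
  pose B' i := if i == i0 then C else B i.
  rewrite [X in Pw X](_ : _ = part n @^-1` V
      `&` \bigcap_(i in [set: 'I_N]) xs i @^-1` B' i); last first.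
    rewrite -setIA; congr (_ `&` _); apply/seteqP; split => w /=.
      move=> [Cw Bw] i _ /=; rewrite /B'; case: eqP => [->//|_]; exact: Bw.
    move=> H; split; first by have := H i0 Logic.I; rewrite /= /B' eqxx.
    move=> i _ /=; have := H i Logic.I; rewrite /= /B'; case: eqP => // -> _.
    by rewrite BT.
  rewrite IH//; [| exact: ltnW | |]; last 2 first.
  - by move=> i; rewrite /B'; case: ifP.
  - move=> i ni; rewrite /B'; case: eqP => [ii|_]; first by rewrite ii ltnn in ni.
    by rewrite BT// ltnW.
  congr (_ * _)%E.
  rewrite (bigD1 i0)//= /c [in RHS](bigD1 i0)//= /B' eqxx BT// probability_setT mul1e muleC.
  by congr (_ * _)%E; apply: eq_bigr => i /negbTE ->.
have E (V : set (D.-tuple R)) : part n.+1 @^-1` V =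
    (fun w => (part n w, xs i0 w)) @^-1` (add_centered @^-1` V).
  by apply/seteqP; split => w /=; rewrite (partS nN).
have mV : measurable (add_centered @^-1` U).
  by rewrite -[X in measurable X]setTI; exact: madd.
(* With trivial events, [key] also evaluates the probability for [part n.+1] alone, through the same
   product measure. *)
rewrite E key//; have := key (fun=> setT) _ mV (fun=> measurableT) (fun _ _ => erefl).
rewrite big1 ?mul1e; last by move=> i _; rewrite probability_setT.
rewrite [X in _ `&` X](_ : _ = setT) ?setIT; last by apply/seteqP; split.
by move=> ->; rewrite muleC.
Qed.

(** Given the past sum, integrating over the next sample costs one factor [expR ((l * r) ^+ 2 / 2)];
    the dimension [D] does not enter. *)
Lemma integral_cosh_partial_sum l n : (n <= N)%N -> 0 <= l ->
  (\int[Pw]_w (cosh (l * norm2 (partial_sum n w)))%:E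
   <= (expR (n%:R * ((l * r) ^+ 2 / 2)))%:E)%E.
Proof.
move=> + l0; elim: n => [_|n IH nN].
  have E0 w : norm2 (partial_sum 0 w) = 0.
    rewrite /norm2 big1 ?sqrtr0// => j _.
    by rewrite /partial_sum big_pred0 ?expr0n.
  under eq_integral do rewrite E0 mulr0 cosh0.
  rewrite (integral_cst Pw measurableT 1%E) mul1e mul0r expR0.
  exact: probability_le1.
pose F (z : D.-tuple R * T) :=
  (cosh (l * norm2 (fun j => tnth z.1 j + (Z j z.2 - mean mu Z j))))%:E.
have F0 z : (0 <= F z)%E by rewrite lee_fin ltW// cosh_gt0.
have mF : measurable_fun setT F.
  apply/measurable_EFinP; apply: (measurableT_comp (@measurable_cosh R)).
  apply: measurable_funM => //.
  apply: measurable_norm2 => j; apply: measurable_funD.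
    by apply: (measurableT_comp (@measurable_tnth _ _ _ j)).
  by apply: measurable_funB => //; exact: measurableT_comp.
have tE w : tnth (part n w) = partial_sum n w.
  by apply/funext => j; rewrite /part tnth_mktuple.
rewrite [leLHS](_ : _ = \int[Pw]_w F (mfpart n w, mfxs (Ordinal nN) w))%E; last first.
  apply: eq_integral => w _; rewrite /F/= tE; congr (cosh (_ * norm2 _))%:E.
  by apply/funext => j; rewrite (partial_sumS nN).
rewrite (@integral_indep_pair _ _ _ _ _ _ _ Pw mu (mfpart n)
  (mfxs (Ordinal nN)))//; last first.
  move=> U C mU mC.
  pose A i := if i == Ordinal nN then C else setT.
  have mA i : measurable (A i) by rewrite /A; case: ifP.
  have AC : (\prod_(i < N) mu (A i) = mu C)%E.
    rewrite (bigD1 (Ordinal nN))//= {1}/A eqxx big1 ?mule1//.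
    by move=> i /negbTE ni; rewrite /A ni probability_setT.
  have := @part_indep n A U (ltnW nN) mU mA.
  rewrite AC => <-; last first.
    by move=> i ni; rewrite /A; case: eqP => // ii; rewrite ii ltnn in ni.
  congr (Pw (_ `&` _)); apply/seteqP; split => w /=.
    by move=> Cw i _ /=; rewrite /A; case: eqP => // ->.
  by move=> /(_ (Ordinal nN) Logic.I); rewrite /= /A eqxx.
apply: (@le_trans _ _ (\int[Pw]_w ((expR ((l * r) ^+ 2 / 2))%:E
    * (cosh (l * norm2 (partial_sum n w)))%:E))%E).
  apply: ge0_le_integral => //.
  - by move=> w _; apply: integral_ge0.
  - exact: (measurableT_comp (measurable_fun_fubini_tonelli_F F mF F0) (mpart n)).
  - under eq_fun do rewrite -EFinM.
    apply/measurable_EFinP; apply: measurable_funM => //.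
    apply: (measurableT_comp (@measurable_cosh R)).
    apply: measurable_funM => //.
    by apply: measurable_norm2 => j; exact: measurable_partial_sum.
  - move=> w _; rewrite -EFinM /F/= tE.
    exact: integral_cosh_step.
rewrite ge0_integralZl//; last 2 first.
- apply/measurable_EFinP; apply: (measurableT_comp (@measurable_cosh R)).
  apply: measurable_funM => //.
  by apply: measurable_norm2 => j; exact: measurable_partial_sum.
- by move=> w _; rewrite lee_fin ltW// cosh_gt0.
rewrite -(natr1 n) mulrDl mul1r addrC expRD EFinM.
apply: lee_wpmul2l; first by rewrite lee_fin expR_ge0.
exact: IH (ltnW nN).
Qed.

Lemma measurable_norm2_partial_sum n :
  measurable_fun setT (fun w => norm2 (partial_sum n w)).
Proof. by apply: measurable_norm2 => j; exact: measurable_partial_sum. Qed.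

Lemma partial_sum_tail (u : R) : 0 < r -> (0 < N)%N -> 0 <= u ->
  (Pw [set w | r * Num.sqrt (2 * N%:R * u) <= norm2 (partial_sum N w)]%R
   <= (2 * expR (- u))%:E)%E.
Proof.
move=> r0 N0 u0; set t := r * Num.sqrt _; set A := [set w | _].
have N0' : 0 < N%:R :> R by rewrite ltr0n.
have t0 : 0 <= t by rewrite mulr_ge0 ?sqrtr_ge0// ltW.
have t2 : t ^+ 2 = r ^+ 2 * (2 * N%:R * u).
  by rewrite exprMn sqr_sqrtr// !mulr_ge0// ltW.
(* This [l] minimises [N * (l * r)^2 / 2 - l * t]; the two terms become [u] and [2 * u]. *)
pose l := t / (N%:R * r ^+ 2).
have l0 : 0 <= l by rewrite divr_ge0// mulr_ge0 ?sqr_ge0// ltW.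
have rn0 : r != 0 by rewrite gt_eqF.
have Nn0 : (N%:R : R) != 0 by rewrite gt_eqF.
have lt : l * t = 2 * u.
  by rewrite /l mulrAC -expr2 t2; field; rewrite Nn0 rn0.
have mA : measurable A.
  rewrite -[A]setTI (_ : A = (fun w => norm2 (partial_sum N w)) @^-1` `[t, +oo[).
    by apply: (measurable_norm2_partial_sum N) => //; exact: measurable_itv.
  by apply/seteqP; split => w /=; rewrite in_itv/= andbT.
(* Markov's inequality, with cosh bounded below by half an exponential: this is the source of the
   factor 2 in the tail. *)
have E : ((expR (2 * u) / 2)%:E * Pw A <= (expR u)%:E)%E.
  have := integral_cosh_partial_sum (leqnn N) l0.
  have -> : N%:R * ((l * r) ^+ 2 / 2) = u.
    rewrite exprMn /l expr_div_n t2; field.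
    by rewrite Nn0 rn0.
  apply: le_trans.
  rewrite -[in leLHS](setIT A) -integral_indic// -ge0_integralZl//.
  - apply: ge0_le_integral => //.
    + by apply: emeasurable_funM => //; apply/measurable_EFinP; exact: measurable_indic.
    + apply/measurable_EFinP; apply: (measurableT_comp (@measurable_cosh R)).
      by apply: measurable_funM => //; exact: measurable_norm2_partial_sum.
    move=> w _; rewrite indicE; have [wA|wA] := boolP (w \in A); last first.
      by rewrite mule0 lee_fin ltW// cosh_gt0.
    rewrite mule1 lee_fin; move: wA; rewrite inE /A/= => wA.
    apply: (@le_trans _ _ (cosh (l * t))).
      by rewrite lt /cosh ler_pM2r// lerDl expR_ge0.
    by apply: cosh_le; [exact: mulr_ge0 | rewrite ler_wpM2l].
  - by apply/measurable_EFinP; exact: measurable_indic.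
have Pfin : Pw A \is a fin_num by rewrite fin_num_measure.
rewrite -(fineK Pfin) lee_fin; move: E; rewrite -(fineK Pfin) -EFinM lee_fin.
have -> : 2 * u = u + u by ring.
rewrite expRD expRN; move: (fine _) (expR u) (expR_gt0 u) => q e e0 H.
have H' : e * (q * e) <= e * 2 by lra.
by rewrite ler_pdivlMr// -(ler_pM2l e0).
Qed.

Lemma empirical_mean_tail (u : R) : 0 < r -> (0 < N)%N -> 0 <= u ->
  exists E : set O, [/\ measurable E, (Pw (~` E) <= (2 * expR (- u))%:E)%E &
    forall w, E w ->
      norm2 (fun j => N%:R^-1 * (\sum_(i < N) Z j (xs i w)) - mean mu Z j)
      <= r * Num.sqrt (2 / N%:R * u)].
Proof.
move=> r0 N0 u0; set t := r * Num.sqrt (2 * N%:R * u).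
have mE : measurable [set w | norm2 (partial_sum N w) <= t].
  rewrite -[X in measurable X]setTI.
  rewrite (_ : [set w | _] = (fun w => norm2 (partial_sum N w)) @^-1` `]-oo, t]).
    by apply: (measurable_norm2_partial_sum N) => //; exact: measurable_itv.
  by apply/seteqP; split => w /=; rewrite in_itv.
have mA : measurable [set w | t <= norm2 (partial_sum N w)].
  rewrite -[X in measurable X]setTI.
  rewrite (_ : [set w | _] = (fun w => norm2 (partial_sum N w)) @^-1` `[t, +oo[).
    by apply: (measurable_norm2_partial_sum N) => //; exact: measurable_itv.
  by apply/seteqP; split => w /=; rewrite in_itv/= andbT.
exists [set w | norm2 (partial_sum N w) <= t]; split => //.
  apply: le_trans (partial_sum_tail r0 N0 u0).
  apply: le_measure; rewrite ?inE//; first exact: measurableC.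
  by move=> w /= /negP; rewrite -ltNge => /ltW.
move=> w /= Ew; have N0' : 0 < N%:R :> R by rewrite ltr0n.
have Nn0 : (N%:R : R) != 0 by rewrite gt_eqF.
have -> : (fun j => N%:R^-1 * (\sum_(i < N) Z j (xs i w)) - mean mu Z j)
    = (fun j => N%:R^-1 * partial_sum N w j).
  apply/funext => j; rewrite /partial_sum [in RHS](eq_bigl xpredT); last first.
    by move=> i; rewrite ltn_ord.
  by rewrite big_split/= sumr_const card_ord mulrDr mulNrn mulrN
    -(mulr_natl (mean mu Z j)) mulKf.
have -> : norm2 (fun j => N%:R^-1 * partial_sum N w j) = N%:R^-1 * norm2 (partial_sum N w).
  rewrite /norm2; under eq_bigr do rewrite exprMn.
  by rewrite -mulr_sumr sqrtrM ?sqr_ge0// sqrtr_sqr ger0_norm// invr_ge0 ltW.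
have -> : r * Num.sqrt (2 / N%:R * u) = N%:R^-1 * t.
  rewrite /t (_ : 2 / N%:R * u = (N%:R^-1) ^+ 2 * (2 * N%:R * u)); last by field.
  by rewrite sqrtrM ?sqr_ge0// sqrtr_sqr ger0_norm ?invr_ge0 ?ltW// mulrCA.
by rewrite ler_wpM2l// invr_ge0 ltW.
Qed.

End IidSum.

Lemma norm2_reindex (R : realType) (I J : finType) (h : J -> I) (s : I -> R) :
  bijective h -> norm2 (fun j => s (h j)) = norm2 s.
Proof.
move=> bh; rewrite /norm2; congr Num.sqrt.
by rewrite [RHS](reindex h)//; exact: onW_bij.
Qed.

(** Enumerating [I] reduces to the ordinals that index the tuples above; pairs are then allowed as
    indices. *)
Lemma empirical_mean_concentration (R : realType) (I : finType) dO dT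
    (O : measurableType dO) (T : measurableType dT)
    (Pw : probability O R) (mu : probability T R) (N : nat)
    (xs : 'I_N -> O -> T) (Z : I -> T -> R) (r u : R) :
  (forall i, measurable_fun setT (xs i)) ->
  (forall A : 'I_N -> set T, (forall i, measurable (A i)) ->
    Pw (\bigcap_(i in [set: 'I_N]) xs i @^-1` A i) = (\prod_(i < N) mu (A i))%E) ->
  (forall j, measurable_fun setT (Z j)) ->
  (forall t, norm2 (Z ^~ t) <= r) ->
  0 < r -> (0 < N)%N -> 0 <= u ->
  exists E : set O, [/\ measurable E, (Pw (~` E) <= (2 * expR (- u))%:E)%E &
    forall w, E w ->
      norm2 (fun j => N%:R^-1 * (\sum_(i < N) Z j (xs i w)) - mean mu Z j)
      <= r * Num.sqrt (2 / N%:R * u)].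
Proof.
move=> mxs iid mZ Zr r0 N0 u0.
have be : bijective (@enum_val I predT) by exact: enum_val_bij.
pose Z' (j : 'I_#|I|) := Z (enum_val j).
have Zr' t : norm2 (Z' ^~ t) <= r.
  by rewrite (norm2_reindex (fun i => Z i t) be).
have [E [mE PE HE]] := empirical_mean_tail mxs iid (fun j => mZ (enum_val j)) Zr' r0 N0 u0.
exists E; split => // w /HE.
by rewrite (norm2_reindex (fun j => N%:R^-1 * (\sum_(i < N) Z j (xs i w)) - mean mu Z j) be).
Qed.

(** * Perturbation of the pseudoinverse *)

Section LinAlg.
Variable R : realType.

Lemma euclid_norm2 n (v : 'cV[R]_n) : euclid v = norm2 (fun i => v i 0).
Proof. by []. Qed.

Lemma euclid_ge0 n (v : 'cV[R]_n) : 0 <= euclid v.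
Proof. exact: norm2_ge0. Qed.

Lemma euclidD n (v w : 'cV[R]_n) : euclid (v + w) <= euclid v + euclid w.
Proof.
rewrite !euclid_norm2; apply: le_trans (norm2D _ _).
by rewrite /norm2; under eq_bigr do rewrite mxE.
Qed.

Lemma euclidZ n (a : R) (v : 'cV[R]_n) : euclid (a *: v) = `|a| * euclid v.
Proof.
rewrite /euclid; under eq_bigr do rewrite mxE exprMn.
by rewrite -mulr_sumr sqrtrM ?sqr_ge0// sqrtr_sqr.
Qed.

Lemma euclidN n (v : 'cV[R]_n) : euclid (- v) = euclid v.
Proof. by rewrite -scaleN1r euclidZ normrN1 mul1r. Qed.

Lemma euclid0 n : euclid (0 : 'cV[R]_n) = 0.
Proof. by rewrite -(scale0r 0) euclidZ normr0 mul0r. Qed.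

Lemma euclid_eq0 n (v : 'cV[R]_n) : euclid v = 0 -> v = 0.
Proof.
move=> /eqP; rewrite sqrtr_eq0 => v0; apply/matrixP => i j.
have /eqP s0 : \sum_i v i 0 ^+ 2 == 0.
  by rewrite eq_le v0 (sum_sqr_ge0 (fun i => v i 0)).
have /eqP : v i 0 ^+ 2 = 0 by apply: (psumr_eq0P _ s0) => // l _; exact: sqr_ge0.
by rewrite sqrf_eq0 mxE (ord1 j) => /eqP.
Qed.

Lemma trmx_mul_dot n (u v : 'cV[R]_n) :
  (u^T *m v) 0 0 = dot (fun i => u i 0) (fun i => v i 0).
Proof. by rewrite mxE; apply: eq_bigr => i _; rewrite mxE. Qed.

Lemma euclid_sqr n (v : 'cV[R]_n) : euclid v ^+ 2 = (v^T *m v) 0 0.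
Proof.
rewrite trmx_mul_dot euclid_norm2 norm2_sqr.
by apply: eq_bigr => i _; rewrite expr2.
Qed.

(** It dominates the operator norm and is a Euclidean norm of the entries, hence within reach of
    vector concentration. *)
Definition fro_norm m n (A : 'M[R]_(m, n)) : R :=
  norm2 (fun p : 'I_m * 'I_n => A p.1 p.2).

Lemma euclid_mulmx_fro m n (A : 'M[R]_(m, n)) x :
  euclid (A *m x) <= fro_norm A * euclid x.
Proof.
rewrite -(@ler_pXn2r _ 2)// ?nnegrE ?euclid_ge0//; last first.
  by rewrite mulr_ge0 ?norm2_ge0// euclid_ge0.
rewrite exprMn !norm2_sqr -(pair_bigA _ (fun i j => A i j ^+ 2))/= mulr_suml.
apply: ler_sum => i _; rewrite mxE.
by have := dot_sqr_le (A i) (fun j => x j 0); rewrite !norm2_sqr.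
Qed.

(** By scaling to the unit ball. The supremum is genuine: its set contains the value at 0 and is
    bounded by the Frobenius norm. *)
Lemma euclid_mulmx_spec m n (A : 'M[R]_(m, n)) x :
  euclid (A *m x) <= spec_norm A * euclid x.
Proof.
have [->|x0] := eqVneq x 0; first by rewrite mulmx0 !euclid0 mulr0.
have xp : 0 < euclid x.
  rewrite lt_neqAle euclid_ge0 andbT eq_sym.
  by apply: contra_neq x0 => /euclid_eq0.
rewrite -ler_pdivrMr//.
have -> : euclid (A *m x) / euclid x = euclid (A *m ((euclid x)^-1 *: x)).
  by rewrite -scalemxAr euclidZ ger0_norm ?invr_ge0 ?euclid_ge0// mulrC.
apply: sup_upper_bound; last first.
  exists ((euclid x)^-1 *: x) => //=.
  by rewrite euclidZ ger0_norm ?invr_ge0 ?euclid_ge0// mulVf// gt_eqF.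
split; first by exists (euclid (A *m 0)); exists 0 => //=; rewrite euclid0.
exists (fro_norm A) => _ [y /= y1 <-]; apply: le_trans (euclid_mulmx_fro _ _) _.
by rewrite ler_piMr// norm2_ge0.
Qed.

Lemma col_mulmx m n p (A : 'M[R]_(m, n)) (C : 'M[R]_(n, p)) j :
  col j (A *m C) = A *m col j C.
Proof. by rewrite !colE mulmxA. Qed.

(** Full column rank, in the form that a lower bound on [euclid (A *m v)] yields directly. *)
Definition mx_inj m n (A : 'M[R]_(m, n)) := forall v : 'cV[R]_n, A *m v = 0 -> v = 0.

Lemma rank_mx_inj m n (A : 'M[R]_(m, n)) : \rank A = n -> mx_inj A.
Proof.
move=> rA v Av; have /row_freeP[B AB] : row_free A^T by rewrite /row_free mxrank_tr rA.
have BA : B^T *m A = 1%:M by rewrite -[A]trmxK -trmx_mul AB trmx1.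
by rewrite -[v]mul1mx -BA -mulmxA Av mulmx0.
Qed.

Lemma mx_inj_mulI m n p (A : 'M[R]_(m, n)) (C : 'M[R]_(n, p)) :
  mx_inj A -> A *m C = 0 -> C = 0.
Proof.
move=> iA AC; apply/matrixP => i j.
have : col j C = 0 by apply: iA; rewrite -col_mulmx AC col0.
by move=> /matrixP /(_ i 0); rewrite !mxE.
Qed.

(** If the Gram matrix kills a column [c], then the squared length of [A *m c] is 0, and injectivity
    gives [c = 0]. *)
Lemma gram_unitmx m n (A : 'M[R]_(m, n)) : mx_inj A -> A^T *m A \in unitmx.
Proof.
move=> iA; rewrite -unitmx_tr -row_free_unit -kermx_eq0; apply/eqP.
set G := _^T; have : kermx G *m G = 0 by exact: mulmx_ker.
move=> /(congr1 trmx); rewrite trmx_mul trmx0 trmxK => /matrixP H.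
apply: trmx_inj; rewrite trmx0; set C := (kermx G)^T in H *.
apply: (mx_inj_mulI iA); apply/matrixP => i j.
have : col j (A *m C) = 0.
  apply: euclid_eq0; apply/eqP; rewrite -sqrf_eq0 euclid_sqr col_mulmx trmx_mul -mulmxA.
  rewrite [X in _ *m X](_ : _ = 0) ?mulmx0 ?mxE//.
  by rewrite mulmxA -col_mulmx; apply/matrixP => a b; rewrite mxE H !mxE.
by move=> /matrixP /(_ i 0); rewrite !mxE.
Qed.

(** The witness [invmx (A^T *m A) *m A^T] satisfies the four Penrose equations, hence so does the
    matrix chosen by [xget]. *)
Lemma mp_pinvP m n (A : 'M[R]_(m, n)) : mx_inj A -> is_MP_pinv A (mp_pinv A).
Proof.
move=> iA; have uG := gram_unitmx iA.
apply: (xgetPex 0); exists (invmx (A^T *m A) *m A^T).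
have BA : invmx (A^T *m A) *m A^T *m A = 1%:M by rewrite -mulmxA mulVmx.
split.
- by rewrite -mulmxA BA mulmx1.
- by rewrite BA mul1mx.
- by rewrite !trmx_mul trmxK trmx_inv trmx_mul trmxK mulmxA.
- by rewrite BA trmx1.
Qed.

Lemma mp_pinvK m n (A : 'M[R]_(m, n)) : mx_inj A -> mp_pinv A *m A = 1%:M.
Proof.
move=> iA; have [ABA _ _ _] := mp_pinvP iA.
apply/eqP; rewrite -subr_eq0; apply/eqP/(mx_inj_mulI iA).
by rewrite mulmxBr mulmxA ABA mulmx1 subrr.
Qed.

(** [E] is symmetric and idempotent, an orthogonal projection, so the squared length of [E *m u] is
    its inner product with [u]. *)
Lemma mp_proj_contract m n (A : 'M[R]_(m, n)) u : mx_inj A ->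
  euclid (A *m (mp_pinv A *m u)) <= euclid u.
Proof.
move=> iA; have [ABA _ sE _] := mp_pinvP iA.
rewrite mulmxA; set E := A *m mp_pinv A in sE *.
have EE : E *m E = E by rewrite {1}/E /E mulmxA ABA.
have H : euclid (E *m u) ^+ 2 <= euclid u * euclid (E *m u).
  rewrite euclid_sqr trmx_mul sE -mulmxA (mulmxA E) EE trmx_mul_dot.
  by rewrite (le_trans (ler_norm _))// dot_le.
have [->|n0] := eqVneq (euclid (E *m u)) 0; first exact: euclid_ge0.
have np : 0 < euclid (E *m u) by rewrite lt_neqAle eq_sym n0 euclid_ge0.
by rewrite -(ler_pM2r np) -expr2.
Qed.

Lemma euclid_le_spec m n (A : 'M[R]_(m, n)) v : mx_inj A ->
  euclid v <= spec_norm (mp_pinv A) * euclid (A *m v).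
Proof.
by move=> iA; apply: le_trans (euclid_mulmx_spec _ _); rewrite mulmxA mp_pinvK ?mul1mx.
Qed.

(** The perturbed pseudoinverse is controlled through [key], without computing its norm: [key] makes
    [Ah] injective, and is then applied to the error, whose image under [Ah] is a projection of the
    residual. *)
Lemma pinv_estimator_error m n (A Ah : 'M[R]_(m, n)) (p q ph qh : 'cV[R]_m) th :
  mx_inj A -> A *m th = q - p ->
  0 <= spec_norm (mp_pinv A) ->
  spec_norm (mp_pinv A) * fro_norm (Ah - A) <= 1 / 4 ->
  3 / 4 * euclid (mp_pinv Ah *m (qh - ph) - th) <= spec_norm (mp_pinv A) *
    (euclid (ph - p) + euclid (qh - q) + fro_norm (Ah - A) * euclid th).
Proof.
move=> iA Ath s0 sA; set s := spec_norm _ in s0 sA *.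
(* Here [3 / 4] is [1 - 1 / 4]: the perturbation of [A] takes back at most a quarter of
   [euclid v]. *)
have key v : 3 / 4 * euclid v <= s * euclid (Ah *m v).
  have := euclid_le_spec v iA; rewrite -/s.
  have -> : A *m v = Ah *m v - (Ah - A) *m v by rewrite mulmxBl opprB addrC subrK.
  have := euclidD (Ah *m v) (- ((Ah - A) *m v)); rewrite euclidN => H1 H2.
  have H3 := ler_wpM2l s0 H1.
  have H4 := ler_wpM2l s0 (euclid_mulmx_fro (Ah - A) v).
  have H5 := ler_wpM2r (euclid_ge0 v) sA.
  rewrite mulrA in H4; rewrite mulrDr in H3.
  by have := le_trans H2 H3; have := le_trans H4 H5; lra.
have iAh : mx_inj Ah.
  move=> v Av; apply: euclid_eq0; have := key v; rewrite Av euclid0 mulr0.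
  by have := euclid_ge0 v; lra.
have -> : mp_pinv Ah *m (qh - ph) - th = mp_pinv Ah *m (qh - ph - Ah *m th).
  by rewrite [RHS]mulmxBr [in RHS]mulmxA mp_pinvK ?mul1mx.
apply: le_trans (key _) _; apply: ler_wpM2l => //.
apply: le_trans (mp_proj_contract _ iAh) _.
(* The identity [A *m th = q - p] splits the residual into the three sampling errors. *)
have -> : qh - ph - Ah *m th = - (ph - p) + (qh - q) + - ((Ah - A) *m th).
  by rewrite mulmxBl Ath; apply/matrixP => i j; rewrite !mxE; ring.
apply: le_trans (euclidD _ _) _; rewrite euclidN; apply: lerD.
  by apply: le_trans (euclidD _ _) _; rewrite euclidN.
exact: euclid_mulmx_fro.
Qed.

(** A negative value would contradict [euclid_le_spec] at a nonzero vector, which [n.+1] columns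
    provide. *)
Lemma spec_pinv_ge0 m n (A : 'M[R]_(m, n.+1)) : mx_inj A -> 0 <= spec_norm (mp_pinv A).
Proof.
move=> iA; have := euclid_le_spec (delta_mx 0 0) iA.
set v := delta_mx _ _; have v0 : 0 < euclid v.
  rewrite lt_neqAle euclid_ge0 andbT eq_sym; apply/eqP => /euclid_eq0 /matrixP /(_ 0 0).
  by rewrite !mxE eqxx => /eqP; rewrite oner_eq0.
move=> H; rewrite leNgt; apply/negP => s0.
have := mulr_le0_ge0 (ltW s0) (euclid_ge0 (A *m v)); lra.
Qed.

End LinAlg.

(** * Label shift *)

Lemma integral_mscale dT (T : measurableType dT) (R : realType)
    (m : {measure set T -> \bar R}) (c : {nonneg R}) (D : set T) (f : T -> \bar R) :
  measurable D -> m.-integrable D f ->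
  (\int[mscale c m]_(x in D) f x = c%:num%:E * \int[m]_(x in D) f x)%E.
Proof.
move=> mD fi; have mf := measurable_int _ fi.
rewrite [LHS]integralE [in RHS]integralE.
rewrite !ge0_integral_mscale//; [|exact: measurable_funeneg|exact: measurable_funepos].
have /fineK <- := integrable_pos_fin_num mD fi.
have /fineK <- := integrable_neg_fin_num mD fi.
by rewrite -[X in (_ = _ * X)%E]EFinB -!EFinM -EFinB mulrBr.
Qed.

Section LabelShift.
Context (R : realType) dX (X : measurableType dX) (k d : nat).
Variables (P Q : probability (X * 'I_k.+1)%type R).
Hypothesis hPy : forall j, 0 < label_prob P j.
Hypothesis hshift : label_shift P Q.
Variable g : 'I_d -> X -> R.
Hypothesis hgmeas : forall i, measurable_fun setT (g i).
Hypothesis hgbnd : forall i x, -1 <= g i x <= 1.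

Let lab (j : 'I_k.+1) : set (X * 'I_k.+1) := [set z | z.2 = j].

Lemma labE j : lab j = setT `*` [set j].
Proof. by apply/seteqP; split => -[x y]/=; [split|case]. Qed.

Lemma measurable_lab j : measurable (lab j).
Proof. by rewrite labE; apply: measurableX. Qed.

(** A set inside one label slice is its section times [[set j]], so label shift applies to it. If
    [label_prob Q j] is 0, a case on which [label_shift] is silent, both sides vanish. *)
Lemma label_shift_slice (A : set (X * 'I_k.+1)) j : measurable A -> A `<=` lab j ->
  Q A = ((label_prob Q j / label_prob P j)%:E * P A)%E.
Proof.
move=> mA Aj.
have finP B : measurable B -> (fine (P B))%:E = P B.
  by move=> mB; rewrite fineK// fin_num_measure.
have finQ B : measurable B -> (fine (Q B))%:E = Q B.
  by move=> mB; rewrite fineK// fin_num_measure.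
have mj := measurable_lab j.
have [Qj|Qj] := ltP 0 (label_prob Q j); last first.
  have Q0 : Q (lab j) = 0%E.
    apply/eqP; rewrite eq_le measure_ge0 andbT -(finQ _ mj) lee_fin.
    exact: Qj.
  have -> : Q A = 0%E.
    apply/eqP; rewrite eq_le measure_ge0 andbT -Q0.
    by apply: le_measure; rewrite ?inE.
  have -> : label_prob Q j = 0 by rewrite /label_prob -/(lab j) Q0.
  by rewrite mul0r mul0e.
have AE : A = (ysection A j) `*` [set j].
  apply/seteqP; split => [[x y] Axy|[x y] /= [+ ->]].
    by have /= <- := Aj _ Axy; split => //=; rewrite /ysection/= inE.
  by rewrite /ysection/= inE.
have mS : measurable (ysection A j) by exact: measurable_ysection.
have := hshift Qj mS; rewrite -AE => H.
rewrite -(finQ A)// -(finP A)// -EFinM; congr EFin.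
have Pn : label_prob P j != 0 by rewrite gt_eqF.
have Qn : label_prob Q j != 0 by rewrite gt_eqF.
by rewrite -[LHS](divfK Qn) -H mulrC; ring.
Qed.

Lemma integrable_feature (M : probability (X * 'I_k.+1)%type R) i :
  M.-integrable setT (fun z => (g i z.1)%:E).
Proof.
apply: measurable_bounded_integrable => //.
- by rewrite (le_lt_trans (probability_le1 _ _))// ltry.
- exact: measurableT_comp.
exists 1; split; first exact: num_real.
by move=> x x1 z _ /=; apply: le_trans (ltW x1); rewrite ler_norml.
Qed.

Lemma pop_T_slice (M : probability (X * 'I_k.+1)%type R) i j :
  (\int[M]_z (g i z.1 * (z.2 == j)%:R)%:E = \int[M]_(z in lab j) (g i z.1)%:E)%E.
Proof.
rewrite [RHS]integral_mkcond; apply: eq_integral => z _.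
rewrite patchE; case: ifPn; rewrite ?inE /lab/=.
  by move=> ->; rewrite eqxx mulr1.
by rewrite notin_setE/= => /eqP/negbTE ->; rewrite mulr0.
Qed.

Lemma integral_slice_sum (M : probability (X * 'I_k.+1)%type R) i :
  (\int[M]_z (g i z.1)%:E = \sum_j \int[M]_(z in lab j) (g i z.1)%:E)%E.
Proof.
have E : \big[setU/set0]_(j <- index_enum 'I_k.+1) lab j = setT.
  rewrite -bigcup_seq; apply/seteqP; split => // -[x y] _.
  by exists y => //=; exact: mem_index_enum.
rewrite -integral_bigsetU_EFin.
- by rewrite E.
- exact: measurable_lab.
- exact: index_enum_uniq.
- by move=> a b _ _ [z [/= <- <-]].
- by apply/measurable_EFinP; rewrite E; exact: measurableT_comp.
Qed.

Lemma integrable_slice (M : probability (X * 'I_k.+1)%type R) i j :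
  M.-integrable (lab j) (fun z => (g i z.1)%:E).
Proof. by apply: integrableS (integrable_feature M i) => //; exact: measurable_lab. Qed.

Lemma slice_shift i j :
  (\int[Q]_(z in lab j) (g i z.1)%:E
  = (omega P Q j 0)%:E * \int[P]_(z in lab j) (g i z.1)%:E)%E.
Proof.
rewrite mxE; have c0 : 0 <= label_prob Q j / label_prob P j.
  by rewrite divr_ge0 ?(ltW (hPy j))// fine_ge0.
rewrite (eq_measure_integral (mscale (NngNum c0) P)); last first.
  by move=> A mA Aj; exact: label_shift_slice.
by rewrite integral_mscale//; [exact: measurable_lab | exact: integrable_slice].
Qed.

(** Cut both means along the labels: slice [j] of the [Q]-mean is [omega] at [j] times that of the
    [P]-mean, which is an entry of [pop_T P g]. *)
Lemma pop_T_theta : pop_T P g *m theta P Q = pop_mean Q g - pop_mean P g.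
Proof.
apply/matrixP => i z; rewrite (ord1 z) !mxE.
have finT (M : probability (X * 'I_k.+1)%type R) j :
    (\int[M]_(z in lab j) (g i z.1)%:E)%E \is a fin_num.
  apply: integrable_fin_num; first exact: measurable_lab.
  exact: integrable_slice.
rewrite !integral_slice_sum -!sum_fine//.
rewrite -sumrB; apply: eq_bigr => j _.
rewrite slice_shift mxE pop_T_slice fineM// !mxE/=; ring.
Qed.

End LabelShift.

(** * Concentration of the empirical moments *)

Section Samples.
Context (R : realType) dX (X : measurableType dX) (k d : nat).
Variables (P Q : probability (X * 'I_k.+1)%type R).
Variable g : 'I_d -> X -> R.
Hypothesis hgmeas : forall i, measurable_fun setT (g i).
Hypothesis hgbnd : forall i x, -1 <= g i x <= 1.
Context (N m : nat) dO (O : measurableType dO) (Pw : probability O R).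
Variables (xs : 'I_N -> O -> (X * 'I_k.+1)%type) (xq : 'I_m -> O -> X).
Hypothesis hiid : iid_samples Pw P Q xs xq.
Hypothesis d0 : (0 < d)%N.

(** Its law under [Q] is the marginal from which the target samples are drawn. *)
Let Mfst : {mfun (X * 'I_k.+1)%type >-> X} := mfun_Sub (mem_set measurable_fst).

Lemma bigcap_preimageT (I : finType) (T U : Type) (f : I -> T -> U) :
  \bigcap_(i in [set: I]) (f i @^-1` setT) = setT.
Proof. by apply/seteqP; split. Qed.

Lemma iid_source (A : 'I_N -> set (X * 'I_k.+1)) : (forall i, measurable (A i)) ->
  Pw (\bigcap_(i in [set: 'I_N]) xs i @^-1` A i) = (\prod_(i < N) P (A i))%E.
Proof.
move=> mA; have [_ [_ H]] := hiid.
have := H A (fun=> setT) mA (fun=> measurableT).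
rewrite bigcap_preimageT setIT => ->.
by rewrite [X in (_ * X)%E]big1 ?mule1// => i _; rewrite setXTT probability_setT.
Qed.

Lemma iid_target (B : 'I_m -> set X) : (forall i, measurable (B i)) ->
  Pw (\bigcap_(i in [set: 'I_m]) xq i @^-1` B i)
  = (\prod_(i < m) distribution Q Mfst (B i))%E.
Proof.
move=> mB; have [_ [_ H]] := hiid.
have := H (fun=> setT) B (fun=> measurableT) mB.
rewrite bigcap_preimageT setTI => ->.
rewrite big1 ?mul1e => [|i _]; last exact: probability_setT.
apply: eq_bigr => i _; congr (Q _).
by apply/seteqP; split => -[x y]/=; [case|split].
Qed.

Lemma sum_sqr_feature x : \sum_i g i x ^+ 2 <= d%:R.
Proof.
rewrite -[X in X%:R]card_ord -sumr_const; apply: ler_sum => i _.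
by rewrite -[leRHS](expr1n _ 2) -[leLHS]real_normK ?num_real// lerXn2r ?nnegrE// ler_norml.
Qed.

(** Entries of the matrix [g(x) e_y^T] of one labelled sample; its mean is [pop_T P g]. *)
Let Zmx (p : 'I_d * 'I_k.+1) (z : X * 'I_k.+1) : R := g p.1 z.1 * (z.2 == p.2)%:R.

Let mZmx p : measurable_fun setT (Zmx p).
Proof.
apply: measurable_funM; first exact: measurableT_comp.
by apply: (@measurableT_comp _ _ _ _ _ _ (fun y : 'I_k.+1 => (y == p.2)%:R : R) _ snd).
Qed.

Let norm2_g x : norm2 (g ^~ x) <= Num.sqrt d%:R.
Proof. by rewrite ler_wsqrtr// sum_sqr_feature. Qed.

(** Only the column of the observed label is nonzero, so the bound does not grow with the number of
    classes. *)
Let norm2_Zmx z : norm2 (Zmx ^~ z) <= Num.sqrt d%:R.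
Proof.
rewrite ler_wsqrtr// (le_trans _ (sum_sqr_feature z.1))//.
rewrite -(pair_bigA _ (fun i j => Zmx (i, j) z ^+ 2))/=.
apply: ler_sum => i _; rewrite (bigD1 z.2)//= big1 ?addr0 /Zmx/= ?eqxx ?mulr1//.
by move=> j /negbTE; rewrite eq_sym => ->; rewrite mulr0 expr0n.
Qed.

(** Each estimate fails with probability at most [2 * expR (- u)]. A union bound adds the three,
    whatever the dependence between [emp_p] and [emp_T], which share their samples. *)
Lemma sample_concentration (u : R) : (0 < N)%N -> (0 < m)%N -> 0 <= u ->
  exists E : set O, [/\ measurable E, (Pw (~` E) <= (3 * (2 * expR (- u)))%:E)%E &
  forall w, E w ->
  [/\ euclid (emp_p g (xs ^~ w) - pop_mean P g) <= Num.sqrt d%:R * Num.sqrt (2 / N%:R * u),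
      euclid (emp_q g (xq ^~ w) - pop_mean Q g) <= Num.sqrt d%:R * Num.sqrt (2 / m%:R * u) &
      fro_norm (emp_T g (xs ^~ w) - pop_T P g) <= Num.sqrt d%:R * Num.sqrt (2 / N%:R * u)]].
Proof.
move=> N0 m0 u0; have [mxs [mxq _]] := hiid.
have sd0 : 0 < Num.sqrt d%:R :> R by rewrite sqrtr_gt0 ltr0n.
have [E1 [mE1 PE1 H1]] := empirical_mean_concentration mxs iid_source
  (fun i => measurableT_comp (hgmeas i) measurable_fst)
  (fun z => norm2_g z.1) sd0 N0 u0.
have [E2 [mE2 PE2 H2]] := empirical_mean_concentration mxq iid_target
  hgmeas norm2_g sd0 m0 u0.
have [E3 [mE3 PE3 H3]] := empirical_mean_concentration mxs iid_source
  mZmx norm2_Zmx sd0 N0 u0.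
exists (E1 `&` E2 `&` E3); split; first by apply: measurableI => //; exact: measurableI.
  rewrite !setCI.
  apply: (@le_trans _ _ (Pw (~` E1) + Pw (~` E2) + Pw (~` E3))%E).
    have mC1 := measurableC mE1; have mC2 := measurableC mE2.
    apply: le_trans (measureU2 Pw (measurableU _ _ mC1 mC2) (measurableC mE3)) _.
    by rewrite leeD2r//; exact: measureU2.
  rewrite (_ : 3 * _ = 2 * expR (- u) + 2 * expR (- u) + 2 * expR (- u)); last by ring.
  by rewrite !EFinD !leeD.
move=> w [[/H1 h1 /H2 h2] /H3 h3]; split.
- rewrite euclid_norm2 (_ : (fun i => _) = (fun j => N%:R^-1 *
     (\sum_(i < N) g j (xs i w).1) - mean P (fun i z => g i z.1) j))//.
  by apply/funext => i; rewrite !mxE.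
- rewrite euclid_norm2 (_ : (fun i => _) = (fun j => m%:R^-1 *
     (\sum_(i < m) g j (xq i w)) - mean (distribution Q Mfst) g j))//.
  apply/funext => i; rewrite !mxE; congr (_ - _); rewrite /mean; congr fine.
  rewrite integral_distribution//; first exact/measurable_EFinP.
  exact: (integrable_feature hgmeas hgbnd).
- rewrite /fro_norm (_ : (fun p => _) = (fun p => N%:R^-1 *
     (\sum_(i < N) Zmx p (xs i w)) - mean P Zmx p))//.
  by apply/funext => p; rewrite !mxE.
Qed.

End Samples.

(** * Constants and conclusion *)

Lemma mul_sqrt_le (R : realType) (a c x y : R) : 0 <= a -> 0 <= c ->
  a * x <= c ^+ 2 * y -> Num.sqrt a * Num.sqrt x <= c * Num.sqrt y.
Proof.
move=> a0 c0 H; rewrite -sqrtrM// -[X in X * Num.sqrt y]ger0_norm// -sqrtr_sqr.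
by rewrite -sqrtrM ?sqr_ge0// ler_wsqrtr.
Qed.

(* Labels are 'I_(k.+1): the number of classes is K = k.+1. *)
Theorem theorem1 (R : realType)
  (dX : measure_display) (X : measurableType dX) (k d : nat)
  (P Q : probability (X * 'I_k.+1)%type R)
  (hPy : forall j : 'I_k.+1, 0 < label_prob P j)
  (hshift : label_shift P Q)
  (g : 'I_d -> X -> R)
  (hgmeas : forall i, measurable_fun setT (g i))
  (hgbnd : forall i x, -1 <= g i x <= 1)
  (hrank : \rank (pop_T P g) = k.+1)
  (theta_max : R) (htmax : euclid (theta P Q) <= theta_max)
  (alpha : R) (n N m : nat)
  (halpha : 0 < alpha <= 1) (hN : (0 < N)%N) (hNan : N%:R = alpha * n%:R)
  (hm : (0 < m)%N)
  (dO : measure_display) (O : measurableType dO) (Pw : probability O R)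
  (xs : 'I_N -> O -> (X * 'I_k.+1)%type) (xq : 'I_m -> O -> X)
  (hiid : iid_samples Pw P Q xs xq)
  (delta : R) (hdelta : 0 < delta < 1)
  (hn : 32 / alpha * spec_norm (mp_pinv (pop_T P g)) ^+ 2 * d%:R
          * ln (6 * (d + k.+1)%:R / delta) <= n%:R) :
  exists E : set O, measurable E /\ ((1 - delta)%:E <= Pw E)%E /\
    forall w, E w ->
      euclid (theta_hat g (fun l => xs l w) (fun j => xq j w) - theta P Q)
      <= 2 * spec_norm (mp_pinv (pop_T P g)) *
         (Num.sqrt (d%:R / (alpha * n%:R) * ln (6 * d%:R / delta))
          + Num.sqrt (d%:R / m%:R * ln (6 * d%:R / delta))
          + 2 * theta_max
            * Num.sqrt (2 * d%:R / (alpha * n%:R) * ln (6 * (d + k.+1)%:R / delta))).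
Proof.
have iT := rank_mx_inj hrank.
have s0 := spec_pinv_ge0 iT.
(* Full column rank forces [d >= k.+1]. *)
have d0 : (0 < d)%N.
  by have := rank_leq_row (pop_T P g); rewrite hrank; exact: leq_trans.
move: hdelta => /andP[de0 de1].
have N0 : 0 < N%:R :> R by rewrite ltr0n.
have m0 : 0 < m%:R :> R by rewrite ltr0n.
have dR0 : 0 < d%:R :> R by rewrite ltr0n.
rewrite -hNan.
(* With this value the failure probability [3 * (2 * expR (- u))] is exactly [delta], and [u] is
   below both logarithms of the statement. *)
pose u : R := ln (6 / delta).
set L1 := ln (6 * d%:R / delta); set Lk := ln (6 * (d + k.+1)%:R / delta) in hn *.
set s := spec_norm _ in s0 hn *.
have q0 : 1 < 6 / delta by rewrite ltr_pdivlMr//; lra.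
have u0 : 0 <= u by rewrite ln_ge0// ltW.
have ln_mono (e : nat) : (0 < e)%N -> u <= ln (6 * e%:R / delta).
  move=> e0; have e1 : 1 <= e%:R :> R by rewrite ler1n.
  rewrite ler_ln ?posrE ?(lt_trans ltr01 q0)//.
    by rewrite ler_pM2r ?invr_gt0//; lra.
  by rewrite divr_gt0//; lra.
have uL1 : u <= L1 by exact: ln_mono.
have uLk : u <= Lk by apply: ln_mono; rewrite addn_gt0 d0.
have hN32 : 32 * s ^+ 2 * d%:R * Lk <= N%:R.
  have /andP[a0 _] := halpha.
  rewrite hNan -ler_pdivrMl//; apply: le_trans hn.
  by rewrite le_eqVlt; apply/orP; left; apply/eqP; field; rewrite gt_eqF.
have [E [mE PE HE]] := sample_concentration hgmeas hgbnd hiid d0 hN hm u0.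
exists E; split => //; split.
  have -> : (1 - delta)%:E = (1 - (3 * (2 * expR (- u)))%:E)%E.
    rewrite -EFinB; congr (_ - _)%:E.
    by rewrite /u expRN lnK ?posrE ?(lt_trans ltr01 q0)//; field; rewrite gt_eqF.
  rewrite -[E]setCK probability_setC; last exact: measurableC.
  exact: leeB.
move=> w /HE[hp hq hT].
set a := Num.sqrt d%:R * Num.sqrt (2 / N%:R * u) in hp hT.
set b := Num.sqrt d%:R * Num.sqrt (2 / m%:R * u) in hq.
set c' := Num.sqrt (2 * d%:R / N%:R * Lk).
set a' := Num.sqrt (d%:R / N%:R * L1); set b' := Num.sqrt (d%:R / m%:R * L1).
have dn0 : 0 <= d%:R :> R by rewrite ltW.
(* [3 / 2] is a rational upper bound for the square root of 2, chosen so that its product with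
   [4 / 3] is the constant 2 of the conclusion. *)
have sqrt_bound (M : R) : 0 < M ->
    Num.sqrt d%:R * Num.sqrt (2 / M * u) <= 3 / 2 * Num.sqrt (d%:R / M * L1).
  move=> M0; apply: mul_sqrt_le => //.
  have -> : d%:R * (2 / M * u) = d%:R / M * (2 * u) by ring.
  have -> : (3 / 2) ^+ 2 * (d%:R / M * L1) = d%:R / M * (9 / 4 * L1) by field; rewrite gt_eqF.
  by rewrite ler_wpM2l ?divr_ge0 ?(ltW M0)//; lra.
have aa' : a <= 3 / 2 * a' by exact: sqrt_bound.
have bb' : b <= 3 / 2 * b' by exact: sqrt_bound.
have ac' : a <= c'.
  rewrite -[c']mul1r; apply: mul_sqrt_le => //.
  have -> : d%:R * (2 / N%:R * u) = 2 * d%:R / N%:R * u by ring.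
  by rewrite expr1n mul1r ler_wpM2l// divr_ge0 ?mulr_ge0// ltW.
(* By [hN32] the square of [s * c'] is at most [1 / 16]; this is what the constant 32 is for. *)
have sc : s * c' <= 1 / 4.
  rewrite -(@ler_pXn2r _ 2)// ?nnegrE ?divr_ge0// ?mulr_ge0 ?sqrtr_ge0//.
  rewrite exprMn sqr_sqrtr; last first.
    by rewrite mulr_ge0 ?(le_trans u0 uLk)// divr_ge0 ?mulr_ge0// ltW.
  have -> : s ^+ 2 * (2 * d%:R / N%:R * Lk) = (32 * s ^+ 2 * d%:R * Lk) / N%:R / 16.
    by field; rewrite gt_eqF.
  have : (32 * s ^+ 2 * d%:R * Lk) / N%:R <= 1 by rewrite ler_pdivrMr// mul1r.
  by move: (32 * _ * _ * _ / _) => z; lra.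
have sT : s * fro_norm (emp_T g (xs ^~ w) - pop_T P g) <= 1 / 4.
  apply: le_trans sc; apply: ler_wpM2l => //; exact: le_trans hT ac'.
have := pinv_estimator_error (emp_p g (xs ^~ w)) (emp_q g (xq ^~ w)) iT
  (pop_T_theta hPy hshift hgmeas hgbnd) s0 sT.
rewrite -/(theta_hat g (xs ^~ w) (xq ^~ w)) => H.
have c'0 : 0 <= c' by exact: sqrtr_ge0.
have tm0 : 0 <= theta_max by apply: le_trans htmax; exact: euclid_ge0.
have hTt : fro_norm (emp_T g (xs ^~ w) - pop_T P g) * euclid (theta P Q)
    <= theta_max * c'.
  rewrite mulrC; apply: ler_pM => //; [exact: euclid_ge0|exact: norm2_ge0|].
  exact: le_trans hT ac'.
have tc0 : 0 <= theta_max * c' by exact: mulr_ge0.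
(* The last term enters as [theta_max * c'], where the right-hand side allows three times as
   much. *)
have H2 : s * (euclid (emp_p g (xs ^~ w) - pop_mean P g)
     + euclid (emp_q g (xq ^~ w) - pop_mean Q g)
     + fro_norm (emp_T g (xs ^~ w) - pop_T P g) * euclid (theta P Q))
   <= s * (3 / 2 * (a' + b' + 2 * theta_max * c')).
  by apply: ler_wpM2l => //; lra.
have := le_trans H H2; lra.
Qed.
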